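(* For every non-negative integer $n$, $$Q_5(5n+4)\equiv 0 \pmod 5,\qquad Q_7(7n+5)\equiv 0 \pmod 7,\qquad Q_{11}(11n+6)\equiv 0 \pmod{11}.$$
   Context: A partition of a positive integer $m$ is a non-increasing sequence of positive integers (its parts) summing to $m$. For positive integers $k,m$, $Q_k(m)$ denotes the total number of occurrences of the part $k$ among all partitions of $m$ (a partition in which $k$ appears $t$ times contributes $t$). *)

(* Defs.v *)
From mathcomp Require Import all_boot.
Set Implicit Arguments. Unset Strict Implicit. Unset Printing Implicit Defensive.

Definition is_partition (m : nat) (s : seq nat) : bool :=
  [&& sorted geq s, all (fun x => 0 < x) s & sumn s == m].

Fixpoint seqs_len (b l : nat) : seq (seq nat) :=
  match l with
  | 0 => [:: [::]]
  | l'.+1 => [seq x :: t | x <- iota 1 b, t <- seqs_len b l']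
  end.

(* A finite superset of all partitions of m: sequences of length <= m
   with entries in {1,...,m}. *)
Definition candidates (m : nat) : seq (seq nat) :=
  flatten [seq seqs_len m l | l <- iota 0 m.+1].

(* The list of all partitions of m (each exactly once). *)
Definition partitions (m : nat) : seq (seq nat) :=
  [seq s <- candidates m | is_partition m s].

Definition Q (k m : nat) : nat :=
  \sum_(s <- partitions m) count_mem k s.

(* Main.v *)
Require Import Defs.
From mathcomp Require Import all_boot all_algebra ring zify.
Set Implicit Arguments. Unset Strict Implicit. Unset Printing Implicit Defensive.

(** Removing one part k from a partition of m + k that contains it gives
    Q_k(m + k) = Q_k(m) + p(m), so Q_k(k n + r) is the sum of the p(k j + r) with
    j < n, and it remains to prove Ramanujan's congruences for p.
    Let E be the product of the 1 - X^i, i >= 1. Modulo the prime p, E^p is a series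
    in X^p, so in P = E^(kp-1) / E^(kp) the coefficients of P of index r mod p vanish
    as soon as those of E^(kp-1) do. The exponents of E are pentagonal numbers (Euler)
    and E^3 = J is the sum of (-1)^j (2j+1) X^(j(j+1)/2) (Jacobi). For 5 and 7 one uses
    E^4 = E J and E^6 = J^2. For 11 (Hirschhorn), E^21 = J^7 and J^4 = E^12 = E E^11:
    the classes missing from the pentagonal numbers give five quartic relations
    between the parts of J in the residue classes mod 11, and the class 6 part of J^7
    is in the ideal they generate. *)

(** * Partitions *)

Lemma mem_seqs_len b l s :
  (s \in seqs_len b l) = (size s == l) && all (fun x => 0 < x <= b) s.
Proof.
elim: l s => [|l IHl] [|x s] //=.
  by apply/negbTE/negP => /allpairsP[[y t] [_ _]].
apply/allpairsP/idP => [[[y t] /= [yb tl [-> ->]]]|].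
  by move: yb tl; rewrite mem_iota IHl add1n ltnS eqSS => -> /andP[-> ->].
rewrite eqSS => /and3P[sl xb sb]; exists (x, s).
by rewrite /= mem_iota add1n ltnS IHl xb sl sb.
Qed.

Lemma uniq_seqs_len b l : uniq (seqs_len b l).
Proof.
elim: l => [|l IHl] //=; apply: allpairs_uniq => //; first exact: iota_uniq.
by move=> [x s] [y t] _ _ /= [-> ->].
Qed.

Lemma uniq_candidates m : uniq (candidates m).
Proof.
rewrite -[candidates m]map_id /candidates map_flatten -map_comp.
apply: (@allpairs_uniq_dep _ _ _ (fun _ t => t)); first exact: iota_uniq.
  by move=> l _; exact: uniq_seqs_len.
move=> _ _ /allpairsPdep[l [s [_ sl ->]]] /allpairsPdep[k [t [_ tk ->]]] /= st.
move: sl tk; rewrite -st !mem_seqs_len => /andP[/eqP <- _] /andP[/eqP <- _].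
by [].
Qed.

Lemma uniq_partitions m : uniq (partitions m).
Proof. exact: filter_uniq (uniq_candidates m). Qed.

Lemma leq_sumn x s : x \in s -> x <= sumn s.
Proof.
elim: s => //= y s IHs; rewrite inE => /orP[/eqP->|/IHs]; first exact: leq_addr.
by move/leq_trans; apply; exact: leq_addl.
Qed.

Lemma size_leq_sumn s : all (fun x => 0 < x) s -> size s <= sumn s.
Proof. by elim: s => //= x s IHs /andP[x0 /IHs]; lia. Qed.

(** The bounds in [candidates] lose nothing: positive parts with sum [m] number at most [m], and
    each is at most [m]. *)
Lemma mem_partitions m s : (s \in partitions m) = is_partition m s.
Proof.
rewrite mem_filter andb_idr // => /and3P[_ s0 /eqP sm].
apply/flatten_mapP; exists (size s).
  by rewrite mem_iota add0n ltnS -sm size_leq_sumn.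
rewrite mem_seqs_len eqxx; apply/allP => x xs.
by rewrite (allP s0) // -sm leq_sumn.
Qed.

(** * Inserting and removing a part *)

Definition insert_part (k : nat) (s : seq nat) := sort geq (k :: s).

Lemma perm_insert_part k s : perm_eq (insert_part k s) (k :: s).
Proof. by rewrite perm_sort. Qed.

Lemma geq_total : total geq. Proof. by move=> x y; exact: leq_total. Qed.
Lemma geq_trans : transitive geq. Proof. by move=> x y z yx /leq_trans; apply. Qed.
Lemma geq_anti : antisymmetric geq.
Proof. by move=> x y; rewrite /geq /= andbC => /anti_leq. Qed.

Lemma is_partition_insert k m s :
  0 < k -> is_partition m s -> is_partition (m + k) (insert_part k s).
Proof.
move=> k0 /and3P[_ s0 /eqP <-]; apply/and3P; split.
- exact: sort_sorted geq_total _.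
- by rewrite (perm_all _ (perm_insert_part k s)) /= k0.
- by rewrite (perm_sumn (perm_insert_part k s)) /= addnC.
Qed.

Lemma insert_part_rem k s : sorted geq s -> k \in s -> insert_part k (rem k s) = s.
Proof.
move=> s_sorted ks; apply: (sorted_eq geq_trans geq_anti) => //.
  exact: sort_sorted geq_total _.
by rewrite (permPl (perm_insert_part _ _)) perm_sym perm_to_rem.
Qed.

Lemma is_partition_rem k m s :
  is_partition (m + k) s -> k \in s -> is_partition m (rem k s).
Proof.
move=> /and3P[s_sorted s0 /eqP sm] ks; apply/and3P; split.
- exact: (subseq_sorted geq_trans (rem_subseq k s)).
- by apply/allP => x /mem_rem; exact: (allP s0).
- by move: sm; rewrite (perm_sumn (perm_to_rem ks)) /= addnC => /addIn->.
Qed.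

Lemma insert_part_inj k :
  {in [pred s | sorted geq s] &, injective (insert_part k)}.
Proof.
move=> s t s_sorted t_sorted st; apply: (sorted_eq geq_trans geq_anti) => //.
rewrite -(perm_cons k) -(permPl (perm_insert_part k s)) st.
exact: perm_insert_part.
Qed.

Lemma perm_partitions_with k m : 0 < k ->
  perm_eq [seq s <- partitions (m + k) | k \in s]
          [seq insert_part k s | s <- partitions m].
Proof.
move=> k0; apply: uniq_perm.
- exact: filter_uniq (uniq_partitions _).
- rewrite map_inj_in_uniq ?uniq_partitions // => s t.
  rewrite !mem_partitions => /andP[s_sorted _] /andP[t_sorted _].
  exact: insert_part_inj.
move=> s; rewrite mem_filter mem_partitions; apply/andP/mapP.
  case=> ks s_part; exists (rem k s).
    by rewrite mem_partitions is_partition_rem.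
  by rewrite insert_part_rem //; case/andP: s_part.
case=> t; rewrite mem_partitions => t_part ->.
by rewrite is_partition_insert // (perm_mem (perm_insert_part k t)) mem_head.
Qed.

Lemma partitions_without k m s : m < k -> s \in partitions m -> k \notin s.
Proof.
move=> mk; rewrite mem_partitions => /and3P[_ _ /eqP sm].
by apply: contraL mk => /leq_sumn; rewrite sm -leqNgt.
Qed.

Lemma Q_small k m : m < k -> Q k m = 0.
Proof.
move=> mk; rewrite /Q big_seq big1 // => s /(partitions_without mk) ks.
exact/count_memPn.
Qed.

(** Partitions without [k] contribute nothing; the others are the partitions of [m] with one more
    [k], which adds 1 for each. *)
Lemma Q_addr k m : 0 < k -> Q k (m + k) = Q k m + size (partitions m).
Proof.
move=> k0; rewrite /Q (bigID (fun s => k \in s)) /= addnC big1 ?add0n => [|s ks].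
  rewrite -big_filter (perm_big _ (perm_partitions_with m k0)) big_map.
  rewrite -sum1_size -big_split; apply: eq_bigr => s _.
  by rewrite (permP (perm_insert_part k s)) /= eqxx addnC.
exact/count_memPn.
Qed.

Lemma dvdn_Q k r : r < k ->
  (forall n, k %| size (partitions (k * n + r))) -> forall n, k %| Q k (k * n + r).
Proof.
move=> rk kp; elim=> [|n IHn]; first by rewrite muln0 Q_small.
by rewrite mulnS -addnA addnC Q_addr ?dvdn_add //; lia.
Qed.

(** * Partitions with bounded parts *)

Definition bounded_count (b m : nat) := count (all (fun x => x <= b)) (partitions m).

Lemma bounded_count0 m : bounded_count 0 m = (m == 0).
Proof.
case: m => [|m] //; rewrite /bounded_count (eq_in_count (a2 := pred0)) ?count_pred0 //.
by case=> [|[|x] s]; rewrite mem_partitions /is_partition ?andbF.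
Qed.

Lemma bounded_count_size b m : m <= b -> bounded_count b m = size (partitions m).
Proof.
move=> mb; apply/eqP; rewrite -all_count; apply/allP => s.
rewrite mem_partitions => /and3P[_ _ /eqP sm]; apply/allP => x /leq_sumn.
by rewrite sm => /leq_trans; apply.
Qed.

(** Split on whether [b.+1] occurs; if it does, remove one copy. *)
Lemma bounded_countS b m : bounded_count b.+1 m =
  bounded_count b m + (if b < m then bounded_count b.+1 (m - b.+1) else 0).
Proof.
have split_all s : all (fun x => x <= b) s = (b.+1 \notin s) && all (fun x => x <= b.+1) s.
  elim: s => //= x s ->; rewrite inE negb_or andbACA; congr (_ && _).
  by lia.
have split_count (a c : pred (seq nat)) r :
    count a r = count (fun s => ~~ c s && a s) r + count (fun s => c s && a s) r.
  by elim: r => //= s r ->; case: (c s) (a s) => [] []; lia.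
rewrite /bounded_count (split_count _ (fun s => b.+1 \in s)).
congr addn; first by apply: eq_count => s; rewrite split_all.
case: ltnP => bm; last first.
  rewrite (eq_in_count (a2 := pred0)) ?count_pred0 // => s /(@partitions_without b.+1 _ _ bm).
  by move/negPf => ->.
rewrite -{1}(subnK bm).
transitivity (count (all (fun x => x <= b.+1))
                [seq s <- partitions (m - b.+1 + b.+1) | b.+1 \in s]).
  by rewrite [RHS]count_filter; apply: eq_count => s /=; rewrite andbC.
rewrite (permP (perm_partitions_with _ _)) // count_map.
apply: eq_count => s /=.
by rewrite (perm_all _ (perm_insert_part b.+1 s)) /= leqnn.
Qed.

Import GRing.Theory.
Local Open Scope ring_scope.

Lemma bin2S k : 'C(k.+2, 2) = ('C(k.+1, 2) + k.+1)%N.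
Proof. by rewrite binS bin1 addnC. Qed.

Lemma double_bin2S k : (2 * 'C(k.+1, 2) = k * k.+1)%N.
Proof. by elim: k => [|k IHk] //; rewrite bin2S mulnDr IHk; lia. Qed.

(** * Finite forms of the identities of Euler and Jacobi *)

Section QSeries.
Variables (R : comNzRingType) (q : R).

Let exprE := (muln0, mulnS, mulSn, (@exprD R), (@exprS R)).

Definition qpoch (m n : nat) : R := \prod_(m <= i < n) (1 - q ^+ i.+1).

Lemma qpochS m n : (m <= n)%N -> qpoch m n.+1 = qpoch m n * (1 - q ^+ n.+1).
Proof. by move=> mn; rewrite /qpoch big_nat_recr. Qed.

Lemma qpoch_recl m n : (m < n)%N -> qpoch m n = (1 - q ^+ m.+1) * qpoch m.+1 n.
Proof. by move=> mn; rewrite /qpoch big_ltn. Qed.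

Lemma qpochnn n : qpoch n n = 1.
Proof. by rewrite /qpoch big_geq. Qed.

Definition shanks_term (n k : nat) : R :=
  (-1) ^+ k * q ^+ (n * k + 'C(k.+1, 2)) * qpoch k n.

(* Shanks' finite form of the pentagonal number theorem: the k = 0 term is the
   product of the 1 - q^i, i <= n, and the others are divisible by q^(n+1). *)
Lemma shanks_telescope n j : (j <= n)%N ->
  \sum_(k < j.+1) (shanks_term n.+1 k - shanks_term n k) =
  (-1) ^+ j.+1 * q ^+ (n * j.+1 + 'C(j.+2, 2)) * qpoch j n.
Proof.
elim: j => [|j IHj] jn.
  by rewrite big_ord1 /shanks_term /= qpochS // bin2S bin_small // !muln0 muln1 !exprE; ring.
rewrite big_ord_recr /= IHj ?(ltnW jn) // /shanks_term (qpochS (m := j.+1)) //.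
rewrite (qpoch_recl jn) !bin2S !exprE; ring.
Qed.

(** In the induction, telescoping at j = n and the new last term give the next pair on the right.
    With K = k+1 its exponents are the pentagonal numbers K(3K-1)/2 and K(3K+1)/2. *)
Lemma shanks n :
  \sum_(k < n.+1) shanks_term n k =
  1 + \sum_(k < n) (-1) ^+ k.+1 * q ^+ (k * k.+1 + 'C(k.+2, 2)) * (1 + q ^+ k.+1).
Proof.
elim: n => [|n IHn].
  by rewrite big_ord1 big_ord0 /shanks_term qpochnn bin_small // mul0n !exprE; ring.
rewrite big_ord_recr [in RHS]big_ord_recr addrA -IHn /=.
rewrite -(subrK (\sum_(k < n.+1) shanks_term n k) (\sum_(k < n.+1) _)).
rewrite -sumrB shanks_telescope // qpochnn /shanks_term qpochnn [(n * n.+1)%N]mulnC.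
rewrite !bin2S !exprE; ring.
Qed.

(* jacobi_coef n j is (-1)^j q^(j(j+1)/2) [2n+1 choose n-j]_q, the coefficient of z^j
   in (1 - z^-1) prod_(1 <= i <= n) (1 - z q^i) (1 - z^-1 q^i), which is defined by the
   recurrence in n. The antisymmetry j <-> -1-j gives the value - jacobi_coef m 0 at
   j = -1; the weights 2j+1 below amount to differentiating at z = 1. *)
Fixpoint jacobi_coef (n j : nat) : R :=
  if n is m.+1 then
    (1 + q ^+ (m.+1 * 2)) * jacobi_coef m j
    - q ^+ m.+1 * ((if j is i.+1 then jacobi_coef m i else - jacobi_coef m 0)
                   + jacobi_coef m j.+1)
  else (j == 0%N)%:R.

Lemma jacobi_coef_gt n j : (n < j)%N -> jacobi_coef n j = 0.
Proof.
elim: n j => [|n IHn] [|j] //= nj.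
by rewrite !IHn; [ring | lia..].
Qed.

(** The two shifts give [f j] the weights 2j+3 and 2j-1, with sum 2(2j+1); the value [- f 0] at
    index -1 supplies the weight -1 for j = 0. The last two terms correct the upper end. *)
Lemma sum_odd_shift (f : nat -> R) N :
  \sum_(j < N.+1) (2 * j + 1)%:R * ((if val j is i.+1 then f i else - f 0) + f j.+1) =
  2%:R * \sum_(j < N.+1) (2 * j + 1)%:R * f j
  + (2 * N + 1)%:R * f N.+1 - (2 * N + 3)%:R * f N.
Proof.
elim: N => [|N IHN]; first by rewrite !big_ord1 /=; ring.
rewrite big_ord_recr IHN [in RHS]big_ord_recr /=; ring.
Qed.

Lemma sum_jacobi_coef n N : (n < N)%N ->
  \sum_(j < N) (2 * j + 1)%:R * jacobi_coef n j = qpoch 0 n ^+ 2.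
Proof.
elim: n N => [|n IHn] [|N] // nN.
  rewrite qpochnn big_ord_recl big1 /= => [|i _]; ring.
rewrite qpochS // exprMn -(IHn N.+1) ?(ltnW nN) //=.
transitivity ((1 + q ^+ (n.+1 * 2)) * \sum_(j < N.+1) (2 * j + 1)%:R * jacobi_coef n j
  - q ^+ n.+1 * \sum_(j < N.+1) (2 * j + 1)%:R *
    ((if val j is i.+1 then jacobi_coef n i else - jacobi_coef n 0) + jacobi_coef n j.+1)).
  rewrite !mulr_sumr -sumrB; apply: eq_bigr => j _ /=; ring.
(* The boundary terms vanish, and the factor 1 + q^(2n+2) - 2q^(n+1) is the square of 1 -
   q^(n+1). *)
rewrite sum_odd_shift !jacobi_coef_gt ?exprM; [ring | lia..].
Qed.

(** The q-binomial formula with denominators cleared, [i] standing for n - j. The recurrence is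
    checked over a common denominator. *)
Lemma jacobi_coefE n i j : n = (i + j)%N ->
  qpoch 0 i * qpoch 0 (i + j + j).+1 * jacobi_coef n j =
  (-1) ^+ j * q ^+ 'C(j.+1, 2) * qpoch 0 (n + n).+1.
Proof.
have qpochS0 k : qpoch 0 k.+1 = qpoch 0 k * (1 - q ^+ k.+1) by exact: qpochS.
elim: n i j => [|n IHn] i j.
  by case: i j => [|i] [|j] //= _; rewrite qpochnn bin_small // !mul1r mulr1.
case: i => [|i] ijn.
  rewrite add0n in ijn; rewrite -ijn /=.
  rewrite (jacobi_coef_gt (j := n.+1)) // (jacobi_coef_gt (j := n.+2)) //.
  rewrite mulr0 addr0 sub0r.
  have := IHn 0%N n (add0n n); rewrite !add0n qpochnn mul1r => IH.
  rewrite !addnS !addSn !(qpochS0 (n + n).+2) !(qpochS0 (n + n).+1) bin2S.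
  transitivity (- q ^+ n.+1 * (1 - q ^+ (n + n).+2) * (1 - q ^+ (n + n).+3) *
     (qpoch 0 (n + n).+1 * jacobi_coef n n)); first ring.
  rewrite IH !exprE; ring.
have {ijn} nE : n = (i + j)%N by case: ijn.
have IH0 := IHn i j nE.
(* The factor [q ^+ j] turns the triangular exponent at j - 1 into that at j; for j = 0 the
   antisymmetric value fits the same formula. *)
have IH1 : q ^+ j * (qpoch 0 i.+1 * qpoch 0 (i + j + j) *
     (if j is k.+1 then jacobi_coef n k else - jacobi_coef n 0)) =
   - (-1) ^+ j * q ^+ 'C(j.+1, 2) * qpoch 0 (n + n).+1.
  case: j nE IH0 => [|k] nE IH0.
    rewrite expr0 mul1r mulrN; move: IH0; rewrite !addn0 => IH0.
    by rewrite [qpoch 0 i.+1 * _]mulrC IH0; ring.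
  have := IHn i.+1 k; rewrite addSnnS => /(_ nE).
  rewrite !addnS !addSn => IH; rewrite IH bin2S !exprE; ring.
(* The factor 1 - q^i raises [qpoch] from i - 1 to i; at i = 0 both sides vanish, as j + 1 > n. *)
have IH2 : qpoch 0 i * qpoch 0 (i + j + j).+2 * jacobi_coef n j.+1 =
   - (1 - q ^+ i) * (-1) ^+ j * q ^+ 'C(j.+2, 2) * qpoch 0 (n + n).+1.
  case: i nE {IH0 IH1} => [|i] nE.
    by rewrite jacobi_coef_gt ?nE // expr0 subrr; ring.
  have := IHn i j.+1; rewrite -addSnnS => /(_ nE) IH.
  rewrite !(addnS, addSn) in IH; rewrite (qpochS0 i) !addSn.
  transitivity ((1 - q ^+ i.+1) *
    (qpoch 0 i * qpoch 0 (i + j + j).+3 * jacobi_coef n j.+1)); first ring.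
  rewrite IH !exprE; ring.
rewrite /=; set c := (match j with 0%N => _ | _ => _ end) in IH1 *.
clearbody c.
transitivity ((1 + q ^+ (n.+1 * 2)) * (1 - q ^+ i.+1) * (1 - q ^+ (i + j + j).+2) *
    (qpoch 0 i * qpoch 0 (i + j + j).+1 * jacobi_coef n j)
  - q ^+ i.+1 * (1 - q ^+ (i + j + j).+1) * (1 - q ^+ (i + j + j).+2) *
    (q ^+ j * (qpoch 0 i.+1 * qpoch 0 (i + j + j) * c))
  - q ^+ n.+1 * (1 - q ^+ i.+1) *
    (qpoch 0 i * qpoch 0 (i + j + j).+2 * jacobi_coef n j.+1)).
  rewrite !addSn !qpochS0 nE !exprE; ring.
rewrite IH0 IH1 IH2 !addnS !addSn !(qpochS0 (n + n).+2) !(qpochS0 (n + n).+1).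
rewrite bin2S nE !exprE; ring.
Qed.

End QSeries.

(** * Congruences modulo a power of X *)

Section Truncation.
Variable F : fieldType.
Implicit Types f g h : {poly F}.

Lemma dvdXnP N f : reflect (forall i, (i < N)%N -> f`_i = 0) ('X^N %| f).
Proof.
apply: (iffP idP) => [/dvdpP[g ->] i iN|fN]; first by rewrite coefMXn iN.
apply/dvdpP; exists (drop_poly N f); rewrite -[LHS](poly_take_drop N).
suff -> : take_poly N f = 0 by rewrite add0r.
by apply/polyP => i; rewrite coef_take_poly coef0; case: ltnP => // /fN.
Qed.

Definition eqXn N f g := 'X^N %| f - g.

Lemma eqXn_refl N f : eqXn N f f.
Proof. by rewrite /eqXn subrr dvdp0. Qed.

Lemma eqXn_sym N f g : eqXn N f g -> eqXn N g f.
Proof. by rewrite /eqXn -opprB dvdpNr. Qed.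

Lemma eqXn_trans N g f h : eqXn N f g -> eqXn N g h -> eqXn N f h.
Proof. by move=> fg gh; rewrite /eqXn -(subrKA g) dvdp_addr. Qed.

Lemma eqXnM N f f' g g' : eqXn N f f' -> eqXn N g g' -> eqXn N (f * g) (f' * g').
Proof.
rewrite /eqXn => ff' gg'.
have -> : f * g - f' * g' = (f - f') * g + f' * (g - g') by ring.
by apply: dvdp_add; [exact: dvdp_mulr | exact: dvdp_mull].
Qed.

Lemma eqXnX N f g n : eqXn N f g -> eqXn N (f ^+ n) (g ^+ n).
Proof.
move=> fg; elim: n => [|n IHn]; first exact: eqXn_refl.
by rewrite !exprS; exact: eqXnM.
Qed.

Lemma eqXn_sum N n (f g : nat -> {poly F}) :
  (forall i, (i < n)%N -> eqXn N (f i) (g i)) ->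
  eqXn N (\sum_(i < n) f i) (\sum_(i < n) g i).
Proof.
move=> fg; rewrite /eqXn -sumrB.
by elim/big_ind: _ => [|u v|i _]; [exact: dvdp0 | exact: dvdp_add | exact: fg].
Qed.

(** * Truncated Euler, pentagonal, Jacobi and partition series *)

Definition euler_poly N : {poly F} := qpoch 'X 0 N.

Lemma euler_polyS N : euler_poly N.+1 = euler_poly N * (1 - 'X^(N.+1)).
Proof. exact: qpochS. Qed.

(** The constant term is 1. This allows cancelling Euler products modulo powers of X. *)
Lemma coprime_euler_poly M N : coprimep 'X^M (euler_poly N).
Proof.
rewrite coprimep_expl // coprimep_sym coprimepX /root.
suff -> : (euler_poly N).[0] = 1 by exact: oner_neq0.
elim: N => [|N IHN]; first by rewrite /euler_poly qpochnn hornerE.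
by rewrite euler_polyS hornerM IHN !hornerE expr0n subr0.
Qed.

Lemma euler_poly_eqXn M N : (M <= N)%N -> eqXn M.+1 (euler_poly N) (euler_poly M).
Proof.
elim: N => [|N IHN]; first by rewrite leqn0 => /eqP ->; exact: eqXn_refl.
rewrite leq_eqVlt => /orP[/eqP -> | MN]; first exact: eqXn_refl.
apply: eqXn_trans (IHN MN); rewrite /eqXn euler_polyS.
have -> : euler_poly N * (1 - 'X^(N.+1)) - euler_poly N = - euler_poly N * 'X^(N.+1) by ring.
by rewrite dvdp_mull ?dvdp_exp2l.
Qed.

Definition pent_poly N : {poly F} :=
  1 + \sum_(k < N) (-1) ^+ k.+1 * 'X^(k * k.+1 + 'C(k.+2, 2)) * (1 + 'X^(k.+1)).

Lemma euler_pentagonal N : eqXn N.+1 (euler_poly N) (pent_poly N).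
Proof.
rewrite /pent_poly -shanks big_ord_recl /= /shanks_term muln0 bin_small // !mul1r.
rewrite /eqXn opprD addNKr dvdpNr.
elim/big_ind: _ => [|u v|i _]; [exact: dvdp0 | exact: dvdp_add | ].
rewrite dvdp_mulr // dvdp_mull // dvdp_exp2l // bin2S /bump /=; nia.
Qed.

Definition tri_poly N : {poly F} :=
  \sum_(j < N.+1) (2 * j + 1)%:R * ((-1) ^+ j * 'X^('C(j.+1, 2))).

(** Multiplying by the coprime denominators leaves two products of Euler polynomials to compare.
    They agree modulo X^(n-j+1), and the triangular power supplies the missing X^j, as j(j+1)/2 >=
    j. *)
Lemma euler_poly_jacobi_coef n j : (j <= n)%N ->
  eqXn n.+1 (euler_poly n * jacobi_coef 'X n j) ((-1) ^+ j * 'X^('C(j.+1, 2))).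
Proof.
move=> jn; have := @jacobi_coefE _ ('X : {poly F}) n (n - j) j.
rewrite subnK // => /(_ erefl); rewrite -!/(euler_poly _).
set i := (n - j)%N => H.
have cop : coprimep 'X^(n.+1) (euler_poly i * euler_poly (n + j).+1).
  by rewrite coprimepMr !coprime_euler_poly.
rewrite /eqXn -(Gauss_dvdpr _ cop) mulrBr.
rewrite mulrCA H.
set s := (-1) ^+ j; set T := 'C(j.+1, 2).
have -> : euler_poly n * (s * 'X^T * euler_poly (n + n).+1) -
  euler_poly i * euler_poly (n + j).+1 * (s * 'X^T) =
  s * ('X^T * (euler_poly n * euler_poly (n + n).+1 - euler_poly i * euler_poly (n + j).+1)).
  ring.
rewrite dvdp_mull //.
apply: (@dvdp_trans _ ('X^T * 'X^(i.+1))).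
  rewrite -exprD dvdp_exp2l // /T /i binS bin1; lia.
apply: dvdp_mul => //; apply: eqXnM; first by apply: euler_poly_eqXn; lia.
apply: (@eqXn_trans _ (euler_poly i)); last apply: eqXn_sym;
  apply: euler_poly_eqXn; lia.
Qed.

Lemma euler_jacobi N : eqXn N.+1 (euler_poly N ^+ 3) (tri_poly N).
Proof.
rewrite exprS [X in _ * X](_ : _ = \sum_(j < N.+1) (2 * j + 1)%:R * jacobi_coef 'X N j).
  rewrite mulr_sumr.
  apply: (eqXn_sum (f := fun j => euler_poly N * ((2 * j + 1)%:R * jacobi_coef 'X N j))
    (g := fun j => (2 * j + 1)%:R * ((-1) ^+ j * 'X^('C(j.+1, 2))))) => j jN.
  by rewrite mulrCA; apply: eqXnM; [exact: eqXn_refl | exact: euler_poly_jacobi_coef].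
by rewrite sum_jacobi_coef.
Qed.

Definition partition_poly N b : {poly F} := \poly_(m < N) (bounded_count b m)%:R.

(** By [bounded_countS], the factor 1 - X^(b+1) turns the series for parts at most b + 1 into that
    for parts at most b. *)
Lemma euler_partition_poly N b : eqXn N (partition_poly N b * euler_poly b) 1.
Proof.
elim: b => [|b IHb].
  rewrite /euler_poly qpochnn mulr1; apply/dvdXnP => i iN.
  by rewrite coefB coef_poly iN bounded_count0 coef1 subrr.
apply: eqXn_trans IHb; rewrite euler_polyS mulrCA mulrC.
apply: eqXnM; last exact: eqXn_refl.
apply/dvdXnP => i iN.
rewrite mulrBr mulr1 !coefB coefMXn !coef_poly iN bounded_countS ltnS.
case: leqP => bi; first by rewrite addn0 subr0 subrr.
by rewrite (leq_ltn_trans (leq_subr _ _) iN) natrD addrK subrr.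
Qed.

End Truncation.

(** * Dissection by residue classes of exponents *)

(** The index [t + (p - s)] represents t - s modulo p without truncated subtraction. *)
Definition cyclic_conv (R : pzSemiRingType) (p : nat) (u v : nat -> R) (t : nat) : R :=
  \sum_(0 <= s < p) u s * v ((t + (p - s)) %% p)%N.

Lemma eq_cyclic_conv (R : pzSemiRingType) (p : nat) (u u' v v' : nat -> R) t :
  (forall s, (s < p)%N -> u s = u' s) -> (forall s, (s < p)%N -> v s = v' s) ->
  cyclic_conv p u v t = cyclic_conv p u' v' t.
Proof.
move=> uu' vv'; apply: eq_big_nat => s sp.
by rewrite uu' // vv' // ltn_mod (leq_ltn_trans _ sp).
Qed.

Section Dissection.
Variables (F : fieldType) (p : nat).
Hypothesis p_gt0 : (0 < p)%N.
Implicit Types f g : {poly F}.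

Definition residue_part r f : {poly F} :=
  \poly_(i < size f) (if (i %% p)%N == r then f`_i else 0).

Lemma coef_residue_part r f i :
  (residue_part r f)`_i = if (i %% p)%N == r then f`_i else 0.
Proof.
rewrite coef_poly; case: ltnP => // fi.
by rewrite nth_default ?if_same.
Qed.

Lemma residue_part_eq0 r f :
  (forall i, (i %% p)%N = r -> f`_i = 0) -> residue_part r f = 0.
Proof.
by move=> f0; apply/polyP => i; rewrite coef_residue_part coef0; case: eqP => // /f0.
Qed.

Lemma residue_partB r f g :
  residue_part r (f - g) = residue_part r f - residue_part r g.
Proof.
apply/polyP => i; rewrite coefB !coef_residue_part coefB.
by case: ifP => // _; rewrite subr0.
Qed.

Lemma residue_part_dvdXn N r f : 'X^N %| f -> 'X^N %| residue_part r f.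
Proof.
move/dvdXnP => fN; apply/dvdXnP => i iN.
by rewrite coef_residue_part fN // if_same.
Qed.

Lemma residue_part_eqXn N r f g :
  eqXn N f g -> eqXn N (residue_part r f) (residue_part r g).
Proof. by move=> fg; rewrite /eqXn -residue_partB residue_part_dvdXn. Qed.

Lemma residue_partM t f g : (t < p)%N ->
  residue_part t (f * g) = cyclic_conv p (residue_part^~ f) (residue_part^~ g) t.
Proof.
move=> tp; rewrite /cyclic_conv big_mkord; apply/polyP => i.
rewrite coef_residue_part coefM coef_sum.
under [RHS]eq_bigr do rewrite coefM.
rewrite exchange_big /=.
transitivity (\sum_(j < i.+1) if (i %% p)%N == t then f`_j * g`_(i - j) else 0).
  by case: ifP => // _; rewrite big1.
apply: eq_bigr => j _.
have jp : (j %% p < p)%N by rewrite ltn_mod.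
(* The index [j] lies in a single class, so only the summand of class j mod p remains. *)
rewrite (bigD1 (Ordinal jp)) //= big1 ?addr0 => [|r /eqP rj]; last first.
  rewrite coef_residue_part; case: eqP => [jr|]; last by rewrite mul0r.
  by case: rj; apply: val_inj.
rewrite !coef_residue_part eqxx.
suff -> : ((i - j) %% p == (t + (p - j %% p)) %% p)%N = (i %% p == t)%N.
  by case: ifP; rewrite ?mulr0.
have ji : (j <= i)%N by rewrite -ltnS.
transitivity (i == (t + (p - j %% p) + j) %[mod p])%N.
  by move: (nat_of_ord j) ji => k ki; rewrite -{2}(subnK ki) eqn_modDr.
have -> : (t + (p - j %% p) + j = (j %/ p).+1 * p + t)%N.
  by rewrite {2}(divn_eq j p) mulSn; lia.
by rewrite modnMDl (modn_small tp).
Qed.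

Lemma residue_partM_multiples r f g : (r < p)%N ->
  (forall i, ~~ (p %| i)%N -> g`_i = 0) ->
  residue_part r (f * g) = residue_part r f * g.
Proof.
move=> rp g0; rewrite mulrC residue_partM // /cyclic_conv big_mkord.
rewrite (bigD1 (Ordinal p_gt0)) //= big1 => [|s s0].
  rewrite addr0 subn0 modnDr modn_small // mulrC; congr (_ * _).
  apply/polyP => i; rewrite coef_residue_part; case: ifP => // /negbT i0.
  by rewrite g0.
rewrite residue_part_eq0 ?mul0r // => i is_; apply: g0.
by rewrite /dvdn is_.
Qed.

(** The products tested are twice the pentagonal exponents; modulo [p] they depend only on k mod p,
    so one period decides. The condition on [r] excludes the constant term 1. *)
Lemma residue_part_pent r N : r != 0%N ->
  all (fun k => (k.+1 * (3 * k + 2) != 2 * r %[mod p]) &&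
                (k.+1 * (3 * k + 4) != 2 * r %[mod p]))%N (iota 0 p) ->
  residue_part r (pent_poly F N) = 0.
Proof.
move=> r0 /allP pent; apply: residue_part_eq0 => i ir.
rewrite /pent_poly coefD coef1 coef_sum.
have -> : (i == 0%N) = false by apply: contraNF r0 => /eqP i0; rewrite -ir i0 mod0n.
rewrite add0r big1 // => k _.
have -> : (-1) ^+ k.+1 = ((-1) ^+ k.+1)%:P :> {poly F} by rewrite rmorphXn rmorphN1.
rewrite -mulrA coefCM mulrDr mulr1 -exprD coefD !coefXn.
have lin_mod c d n : (c * n + d = c * (n %% p) + d %[mod p])%N.
  by rewrite -modnDml -modnMmr modnDml.
have kp : (k %% p)%N \in iota 0 p by rewrite mem_iota ltn_mod.
have /andP[/eqP ne1 /eqP ne2] := pent _ kp.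
have i2 : (2 * i = 2 * r %[mod p])%N by rewrite -modnMmr ir.
have tri := double_bin2S k.+1.
have [ie|_] := eqP.
  case: ne1; rewrite -i2 ie; symmetry.
  rewrite (_ : (2 * _ = k.+1 * (3 * k + 2))%N); last by lia.
  rewrite -modnMm lin_mod -(addn1 (nat_of_ord k)) -[X in (X + 1)%N]mul1n lin_mod mul1n addn1.
  by rewrite modnMm.
have [ie|_] := eqP; last by rewrite addr0 mulr0.
case: ne2; rewrite -i2 ie; symmetry.
rewrite (_ : (2 * _ = k.+1 * (3 * k + 4))%N); last by lia.
rewrite -modnMm lin_mod -(addn1 (nat_of_ord k)) -[X in (X + 1)%N]mul1n lin_mod mul1n addn1.
by rewrite modnMm.
Qed.

(** An exponent may fall in class [r] if its coefficient 2j+1 vanishes in [F]; again one period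
    decides. *)
Lemma residue_part_tri r N : p%:R = 0 :> F ->
  all (fun j => (j * j.+1 == 2 * r %[mod p]) ==> (p %| 2 * j + 1))%N (iota 0 p) ->
  residue_part r (tri_poly F N) = 0.
Proof.
move=> p0 /allP tri; apply: residue_part_eq0 => i ir.
rewrite /tri_poly coef_sum big1 // => j _.
have -> : (-1) ^+ j = ((-1) ^+ j)%:P :> {poly F} by rewrite rmorphXn rmorphN1.
rewrite mulr_natl coefMn coefCM coefXn.
have [ie|_] := eqP; last by rewrite mulr0 mul0rn.
have jp : (j %% p)%N \in iota 0 p by rewrite mem_iota ltn_mod.
have /implyP := tri _ jp.
have -> : (p %| 2 * (j %% p) + 1 = (p %| 2 * j + 1))%N.
  by rewrite /dvdn -modnDml modnMmr modnDml.
have -> : (j %% p * (j %% p).+1 = 2 * r %[mod p])%N.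
  rewrite -ir modnMmr ie double_bin2S.
  by rewrite modnMml -(addn1 (j %% p)) -(addn1 (nat_of_ord j)) -modnMmr modnDml modnMmr.
rewrite eqxx => /(_ isT) /dvdnP[m ->].
by rewrite mulrnA -[_ *+ p]mulr_natr p0 mulr0.
Qed.

End Dissection.

(** * Ramanujan's congruences *)

Section Ramanujan.
Variable p : nat.
Hypothesis p_pr : prime p.
Let F := 'F_p.
Notation E := (euler_poly F).

(** Frobenius is additive, so each factor 1 - X^i has p-th power 1 - X^(pi). *)
Lemma euler_poly_char N : E N ^+ p = E N \Po 'X^p.
Proof.
have charp : p \in [pchar {poly F}] by rewrite pchar_poly pchar_Fp.
elim: N => [|N IHN].
  by rewrite /euler_poly qpochnn expr1n comp_polyC.
rewrite euler_polyS exprMn IHN comp_polyM rmorphB /= rmorphXn /= comp_polyX comp_polyC.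
congr (_ * _); rewrite -!(pFrobenius_autE charp) rmorphB /= rmorph1.
by rewrite pFrobenius_autE -!exprM mulnC.
Qed.

Lemma coef_euler_polyX N k i : ~~ (p %| i)%N -> (E N ^+ (p * k))`_i = 0.
Proof.
move=> pi; rewrite exprM euler_poly_char -rmorphXn /= coef_comp_poly_Xn ?prime_gt0 //.
by rewrite (negPf pi).
Qed.

Lemma ramanujan_of_residue_part r e k : (r < p)%N -> e.+1 = (p * k)%N ->
  (forall N, 'X^(N.+1) %| residue_part p r (E N ^+ e)) ->
  forall n, (p %| size (partitions (p * n + r)))%N.
Proof.
move=> rp ek res_E n; set m := (p * n + r)%N.
(* Bounding parts by [m] and truncating at X^(m+1) keeps p(m) as the coefficient of index [m]. *)
have PE := euler_partition_poly F m.+1 m.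
have PEe : eqXn m.+1 (partition_poly F m.+1 m * E m ^+ (p * k)) (E m ^+ e).
  rewrite -ek exprS mulrA -[X in eqXn _ _ X]mul1r.
  exact: eqXnM PE (eqXn_refl _ _).
have := residue_part_eqXn p r PEe.
rewrite residue_partM_multiples ?prime_gt0 //; last exact: coef_euler_polyX.
rewrite /eqXn dvdp_subl // mulrC Gauss_dvdpr.
  move/dvdXnP/(_ m (ltnSn m)); rewrite coef_residue_part coef_poly ltnSn.
  rewrite /m mulnC modnMDl (modn_small rp) eqxx bounded_count_size //.
  by move/eqP; rewrite -(dvdn_pcharf (pchar_Fp p_pr)).
by rewrite coprimep_expr // coprime_euler_poly.
Qed.

End Ramanujan.

Lemma dvdXn_residue_part (F : fieldType) p N r (f g : {poly F}) :
  eqXn N f g -> residue_part p r g = 0 -> 'X^N %| residue_part p r f.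
Proof. by move/(residue_part_eqXn p r) => fg g0; move: fg; rewrite /eqXn g0 subr0. Qed.

(** The classes left are 0, 1, 2 for E and 0, 1 for J, whose sums never reach 4; class 3 of J
    vanishes because 5 divides 2j+1 there. *)
Lemma ramanujan5 n : (5 %| size (partitions (5 * n + 4)))%N.
Proof.
apply: (@ramanujan_of_residue_part 5 isT 4 4 1) => // N.
apply: (@dvdXn_residue_part _ _ _ _ _ (pent_poly _ N * tri_poly _ N)).
  by rewrite exprS; apply: eqXnM; [exact: euler_pentagonal | exact: euler_jacobi].
have p5 : 5%:R = 0 :> 'F_5 by exact/val_inj.
rewrite residue_partM // /cyclic_conv unlock /=.
have G r : r \in [:: 3; 4]%N -> residue_part 5 r (pent_poly 'F_5 N) = 0.
  by rewrite !inE => /orP[] /eqP ->; exact: residue_part_pent.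
have T r : r \in [:: 2; 3; 4]%N -> residue_part 5 r (tri_poly 'F_5 N) = 0.
  by rewrite !inE => /or3P[] /eqP ->; exact: residue_part_tri.
by rewrite (T 4) // (T 3) // (T 2) // (G 3) // (G 4) //; ring.
Qed.

(** Only classes 0, 1, 3 of J are left, and no two of them add up to 5 modulo 7; in class 6, 7
    divides 2j+1. *)
Lemma ramanujan7 n : (7 %| size (partitions (7 * n + 5)))%N.
Proof.
apply: (@ramanujan_of_residue_part 7 isT 5 6 1) => // N.
apply: (@dvdXn_residue_part _ _ _ _ _ (tri_poly _ N ^+ 2)).
  by rewrite (exprM _ 3 2); apply: eqXnX; exact: euler_jacobi.
have p7 : 7%:R = 0 :> 'F_7 by exact/val_inj.
have T r : r \in [:: 2; 4; 5; 6]%N -> residue_part 7 r (tri_poly 'F_7 N) = 0.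
  by rewrite !inE => /or4P[] /eqP ->; exact: residue_part_tri.
rewrite expr2 residue_partM // /cyclic_conv unlock /=.
by rewrite (T 2) // (T 4) // (T 5) // (T 6) //; ring.
Qed.

(* The cofactors solve a linear system over the field with 11 elements; the multiple
   of 11 lifts the resulting relation to an identity over the integers. *)
Lemma hirschhorn_identity (R : comNzRingType) (t : nat -> R)
  (t2 := cyclic_conv 11 t t) (t3 := cyclic_conv 11 t t2) (t4 := cyclic_conv 11 t2 t2)
  (a := t 0) (b := t 1) (c := t 3) (d := t 6) (e := t 10) :
  (forall r, r \in [:: 2; 4; 5; 7; 8; 9]%N -> t r = 0) ->
  cyclic_conv 11 t4 t3 6 =
    (4%:R * a ^+ 2 * c - b * c * e - b ^+ 3) * t4 3
  + (4%:R * d ^+ 2 * e - a * b * e - a ^+ 3) * t4 6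
  + (4%:R * a * e ^+ 2 - a * c * d - c ^+ 3) * t4 8
  + (4%:R * b ^+ 2 * d - c * d * e - e ^+ 3) * t4 9
  + (4%:R * b * c ^+ 2 - a * b * d - d ^+ 3) * t4 10
  + 11%:R * (
    d ^+ 5 * e ^+ 2 + c * d ^+ 6 + c ^+ 6 * e + b * e ^+ 6 + b ^+ 2 * c ^+ 5 + b ^+ 5 *
    d ^+ 2 + a * b ^+ 6 + a ^+ 2 * e ^+ 5 + a ^+ 5 * c ^+ 2 + a ^+ 6 * d + 12%:R * (b *
    c ^+ 3 * d ^+ 3 + b ^+ 3 * d * e ^+ 3 + a * c ^+ 3 * e ^+ 3 + a ^+ 3 * d ^+ 3 * e +
    a ^+ 3 * b ^+ 3 * c) + 22%:R * (b * c * d * e ^+ 4 + a * c ^+ 4 * d * e + a * b * c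
    * d ^+ 4 + a * b ^+ 4 * c * e + a ^+ 4 * b * d * e) + 30%:R * (b ^+ 3 * c * d ^+ 2 *
    e + a * b * d ^+ 3 * e ^+ 2 + a * b ^+ 2 * c ^+ 3 * d + a ^+ 2 * c * d * e ^+ 3 + a
    ^+ 3 * b * c ^+ 2 * e) + 54%:R * (b * c ^+ 2 * d ^+ 2 * e ^+ 2 + a * b ^+ 2 * c ^+ 2
    * e ^+ 2 + a ^+ 2 * c ^+ 2 * d ^+ 2 * e + a ^+ 2 * b ^+ 2 * d * e ^+ 2 + a ^+ 2 * b
    ^+ 2 * c * d ^+ 2)).
Proof.
move=> t0; rewrite /t4 /t3 /t2 /cyclic_conv unlock /=.
rewrite (t0 2) // (t0 4) // (t0 5) // (t0 7) // (t0 8) // (t0 9) // -/a -/b -/c -/d -/e.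
ring.
Qed.

Lemma ramanujan11 n : (11 %| size (partitions (11 * n + 6)))%N.
Proof.
apply: (@ramanujan_of_residue_part 11 isT 6 21 2) => // N.
set E := euler_poly _ N; set J := tri_poly 'F_11 N.
have EJ : eqXn N.+1 (E ^+ 3) J by exact: euler_jacobi.
have p11 : 11%:R = 0 :> 'F_11 by exact/val_inj.
(* In class 4 the weights 2j+1 are multiples of 11; the other five classes contain no triangular
   number. *)
have J0 r : r \in [:: 2; 4; 5; 7; 8; 9]%N -> residue_part 11 r J = 0.
  by rewrite !inE; do 5?[case/orP]; move=> /eqP ->; exact: residue_part_tri.
have relation r : r \in [:: 3; 6; 8; 9; 10]%N -> 'X^(N.+1) %| residue_part 11 r (J ^+ 4).
  move=> r_in; apply: (@dvdXn_residue_part _ _ _ _ _ (pent_poly _ N * E ^+ 11)).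
    apply: (eqXn_trans (eqXn_sym (eqXnX 4 EJ))); rewrite -exprM exprS.
    by apply: eqXnM; [exact: euler_pentagonal | exact: eqXn_refl].
  rewrite residue_partM_multiples //.
  - rewrite residue_part_pent ?mul0r //; move: r_in; rewrite !inE;
    do 4?[case/orP]; by move=> /eqP ->.
  - by move: r_in; rewrite !inE; do 4?[case/orP]; move=> /eqP ->.
  - by move=> i; rewrite -[X in E ^+ X](muln1 11); exact: coef_euler_polyX.
pose t r := residue_part 11 r J; pose t2 := cyclic_conv 11 t t.
have M := @residue_partM _ 11 isT.
have J2 r : (r < 11)%N -> residue_part 11 r (J ^+ 2) = t2 r by exact: M.
have J3 r : (r < 11)%N -> residue_part 11 r (J ^+ 3) = cyclic_conv 11 t t2 r.
  by move=> r11; rewrite exprS M //; exact: eq_cyclic_conv.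
have J4 r : (r < 11)%N -> residue_part 11 r (J ^+ 4) = cyclic_conv 11 t2 t2 r.
  by move=> r11; rewrite (exprD _ 2 2) M //; exact: eq_cyclic_conv.
have J7 : 'X^(N.+1) %| residue_part 11 6 (J ^+ 7).
  rewrite (exprD _ 4 3) M // (eq_cyclic_conv _ J4 J3) (hirschhorn_identity J0).
  (* The multiple of 11 vanishes in characteristic 11; each other term contains one of the five
     relations. *)
  rewrite -[11%:R]polyC_natr p11 polyC0 mul0r addr0 -!J4 //.
  by rewrite !dvdp_add ?dvdp_mull ?relation.
have /(residue_part_eqXn 11 6) : eqXn N.+1 (E ^+ 21) (J ^+ 7).
  by rewrite (exprM _ 3 7); exact: eqXnX.
by rewrite /eqXn dvdp_subl.
Qed.

Local Close Scope ring_scope.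

Theorem theorem3 : forall n : nat,
  [/\ Q 5 (5 * n + 4) %% 5 = 0,
      Q 7 (7 * n + 5) %% 7 = 0 &
      Q 11 (11 * n + 6) %% 11 = 0].
Proof.
move=> n; split; apply/eqP; rewrite -/(dvdn _ _); apply: dvdn_Q => //.
- exact: ramanujan5.
- exact: ramanujan7.
- exact: ramanujan11.
Qed.
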